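(* Let $G=(V,E,w)$ be a finite connected weighted graph. Suppose $u\colon V\times\mathbb{R}_{\le 0}\to\mathbb{R}$ satisfies $\partial_t u(x,t)=\Delta u(x,t)$ for all $(x,t)\in V\times\mathbb{R}_{\le 0}$. If there exist $x_0\in V$ and positive constants $C$ and $d$ such that $$|u(x,t)|\le C\left(1+\operatorname{dist}(x_0,x)+\sqrt{-t}\right)^d\quad\text{for all }(x,t)\in V\times\mathbb{R}_{\le 0},$$ then $u$ is constant in time and is given by a harmonic function on $G$; that is, there is $h\colon V\to\mathbb{R}$ with $\Delta h=0$ on $V$ and $u(x,t)=h(x)$ for all $(x,t)\in V\times\mathbb{R}_{\le 0}$.
   Context: A weighted graph $G=(V,E,w)$ consists of a vertex set $V$, an edge set $E\subseteq V\times V$ and a weight function $w$ on $E$ with $w_{xy}=w(x,y)>0$ for $(x,y)\in E$; $x\sim y$ means $(x,y)\in E$. Graphs are undirected: $(x,y)\in E$ iff $(y,x)\in E$, and $w_{xy}=w_{yx}$. The vertex weight is $\mu(x)=\sum_{y\sim x}w_{xy}$ and the Laplacian of $f\colon V\to\mathbb{R}$ is $\Delta f(x)=\sum_{y\sim x}\frac{w_{xy}}{\mu(x)}(f(y)-f(x))$; for functions of $(x,t)$ it acts in the $x$ variable. $\operatorname{dist}(x,y)$ is the usual combinatorial graph distance (the least number of edges in a path joining $x$ to $y$). *)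

(* Defs.v *)
From mathcomp Require Import all_boot all_order all_algebra.
From mathcomp Require Import all_classical all_reals all_analysis.

Set Implicit Arguments.
Unset Strict Implicit.
Unset Printing Implicit Defensive.

Import Order.TTheory GRing.Theory Num.Theory.
Import numFieldNormedType.Exports.

Local Open Scope classical_set_scope.
Local Open Scope ring_scope.

(* The weight is a total function, but its values off the edge set are
   unconstrained and never used. Loops are allowed. *)
Record weighted_graph (R : realType) (V : finType) := WeightedGraph {
  edge : rel V;
  weight : V -> V -> R;
  edge_sym : symmetric edge;
  weight_sym : forall x y, edge x y -> weight x y = weight y x;
  weight_gt0 : forall x y, edge x y -> 0 < weight x y }.

Definition connected_graph (R : realType) (V : finType)
  (G : weighted_graph R V) : Prop := forall x y : V, connect (edge G) x y.

Definition vertex_weight (R : realType) (V : finType)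
  (G : weighted_graph R V) (x : V) : R := \sum_(y | edge G x y) weight G x y.

(* At an isolated vertex the sum is empty, so the value is 0. *)
Definition laplacian (R : realType) (V : finType)
  (G : weighted_graph R V) (f : V -> R) (x : V) : R :=
  \sum_(y | edge G x y) weight G x y / vertex_weight G x * (f y - f x).

Definition harmonic_on (R : realType) (V : finType)
  (G : weighted_graph R V) (h : V -> R) : Prop :=
  forall x : V, laplacian G h x = 0.

Definition has_walk (R : realType) (V : finType) (G : weighted_graph R V)
  (x y : V) (n : nat) : bool :=
  [exists p : n.-tuple V, path (edge G) x p && (last x p == y)].

(* Least n such that a walk with n edges joins x to y; it is enough to search
   below #|V| (see [graph_distP]), and the value is #|V| if x and y are not
   connected. *)
Definition graph_dist (R : realType) (V : finType) (G : weighted_graph R V)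
  (x y : V) : nat := find (has_walk G x y) (iota 0 #|V|).

Lemma has_walkP (R : realType) (V : finType) (G : weighted_graph R V)
    (x y : V) (n : nat) :
  reflect (exists p : seq V, [/\ path (edge G) x p, last x p = y & size p = n])
          (has_walk G x y n).
Proof.
apply: (iffP existsP) => [[p /andP[pp /eqP lp]]|[p [pp lp sp]]].
  by exists p; rewrite size_tuple.
by exists (Tuple (introT eqP sp)); rewrite /= pp lp eqxx.
Qed.

Lemma graph_distP (R : realType) (V : finType) (G : weighted_graph R V)
    (x y : V) : connect (edge G) x y ->
  (exists p : seq V,
      [/\ path (edge G) x p, last x p = y & size p = graph_dist G x y]) /\
  (forall p : seq V, path (edge G) x p -> last x p = y ->
      (graph_dist G x y <= size p)%N).
Proof.
move=> cxy.
have hasw : has (has_walk G x y) (iota 0 #|V|).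
  case/connectP: cxy => q /shortenP[q' q'p q'u _] lq'.
  apply/hasP; exists (size q'); last by apply/has_walkP; exists q'.
  rewrite mem_iota add0n /= -[(size q').+1]/(size (x :: q')).
  by rewrite -(card_uniqP q'u) max_card.
have lt : (graph_dist G x y < #|V|)%N.
  by rewrite -[X in (_ < X)%N](size_iota 0) -has_find.
split.
  apply: (elimT (has_walkP G x y _)).
  by have := nth_find 0%N hasw; rewrite nth_iota.
move=> p pp lp; rewrite leqNgt; apply/negP => ltp.
have := before_find 0%N ltp.
rewrite nth_iota ?(ltn_trans ltp) // add0n.
have -> : has_walk G x y (size p) by apply: (introT (has_walkP G x y _)); exists p.
by [].
Qed.

(* Limit of the difference quotient over s in D, s != t: two-sided at interior
   points of D, one-sided at an endpoint. *)
Definition is_derive_within (R : realType) (D : set R) (f : R -> R)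
  (t df : R) : Prop :=
  (f s - f t) / (s - t) @[s --> within D t^'] --> df.

Definition ancient_heat_solution (R : realType) (V : finType)
  (G : weighted_graph R V) (u : V -> R -> R) : Prop :=
  forall (x : V) (t : R), t <= 0 ->
    is_derive_within [set s : R | s <= 0] (u x) t (laplacian G (u ^~ t) x).

(* Main.v *)
Require Import Defs.
From mathcomp Require Import all_boot all_order all_algebra.
From mathcomp Require Import all_classical all_reals all_analysis.
From mathcomp Require Import ring lra.
Import Order.TTheory GRing.Theory Num.Theory.
Import numFieldNormedType.Exports.
Local Open Scope classical_set_scope.
Local Open Scope ring_scope.

Set Implicit Arguments.
Unset Strict Implicit.
Unset Printing Implicit Defensive.

(* Let L be the Laplacian. The energies E = sum_x mu(x) u(x)^2 and
   D = sum_{x~y} w_xy (u(y) - u(x))^2 (over ordered pairs) satisfy E' = - D and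
   D' = - 4 E(Lu), and Lu again solves the heat equation, so all these
   quantities are nonnegative and nonincreasing in time. Hence if E grows at
   most like (1 - t)^(m+2) as t -> -oo, then D grows at most like (1 - t)^(m+1)
   and E(Lu) at most like (1 - t)^m. Induction reduces to bounded E, where
   D = 0 and so Lu = 0; going back up, L(Lu) = 0 implies Lu = 0 because L is
   symmetric. *)

(** * Energies and summation by parts *)

Definition mass (R : realType) (V : finType) (G : weighted_graph R V)
  (f g : V -> R) : R := \sum_x vertex_weight G x * (f x * g x).

(* Sums over ordered pairs, so every edge is counted twice. *)
Definition dirichlet (R : realType) (V : finType) (G : weighted_graph R V)
    (f g : V -> R) : R :=
  \sum_x \sum_(y | edge G x y) weight G x y * ((f y - f x) * (g y - g x)).

(** Only negative times, where the derivative is two-sided and the usual calculus applies; time 0 is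
    recovered by continuity at the very end. *)
Definition heat_before_0 (R : realType) (V : finType) (G : weighted_graph R V)
    (u : V -> R -> R) : Prop :=
  forall x (t : R), t < 0 -> is_derive t 1 (u x) (laplacian G (u ^~ t) x).

Lemma vertex_weight_ge0 (R : realType) (V : finType) (G : weighted_graph R V) x :
  0 <= vertex_weight G x.
Proof. by apply: sumr_ge0 => y /weight_gt0/ltW. Qed.

Lemma vertex_weight_laplacian (R : realType) (V : finType)
    (G : weighted_graph R V) (f : V -> R) x :
  vertex_weight G x * laplacian G f x =
  \sum_(y | edge G x y) weight G x y * (f y - f x).
Proof.
rewrite mulr_sumr; apply: eq_bigr => y xy.
have mu0 : vertex_weight G x != 0.
  rewrite gt_eqF// /vertex_weight (bigD1 y)//=.
  apply: ltr_wpDr; last exact: weight_gt0.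
  by apply: sumr_ge0 => z /andP[/weight_gt0/ltW].
by rewrite mulrA mulrCA divff// mulr1.
Qed.

Lemma laplacian_eq0 (R : realType) (V : finType) (G : weighted_graph R V)
    (f : V -> R) x :
  vertex_weight G x * laplacian G f x = 0 -> laplacian G f x = 0.
Proof.
have [mu0 _|mu0 /eqP] := eqVneq (vertex_weight G x) 0.
  (* Division by zero yields zero, so every term of the Laplacian vanishes here. *)
  by apply: big1 => y _; rewrite mu0 invr0 mulr0 mul0r.
by rewrite mulf_eq0 (negbTE mu0) => /eqP.
Qed.

Lemma sum_edge_sym (R : realType) (V : finType) (G : weighted_graph R V)
    (F : V -> V -> R) :
  \sum_x \sum_(y | edge G x y) weight G x y * F x y =
  \sum_x \sum_(y | edge G x y) weight G x y * F y x.
Proof.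
rewrite [LHS](exchange_big_dep predT)//=; apply: eq_bigr => x _.
rewrite (eq_bigl (edge G x)) => [|y]; last exact: edge_sym.
by apply: eq_bigr => y xy; rewrite (weight_sym xy).
Qed.

(** Summation by parts: of the two copies of [mass], one has the endpoints of each edge exchanged,
    and the two add up to the product of differences. *)
Lemma green (R : realType) (V : finType) (G : weighted_graph R V)
    (f g : V -> R) :
  dirichlet G f g = - (2 * mass G f (laplacian G g)).
Proof.
have -> : mass G f (laplacian G g) =
    \sum_x \sum_(y | edge G x y) weight G x y * (f x * (g y - g x)).
  apply: eq_bigr => x _; rewrite mulrCA vertex_weight_laplacian mulr_sumr.
  by apply: eq_bigr => y _; rewrite mulrCA.
rewrite mulr_natl mulr2n opprD [in X in - X + _]sum_edge_sym -!sumrN -big_split.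
apply: eq_bigr => x _; rewrite -!sumrN -big_split.
by apply: eq_bigr => y _ /=; ring.
Qed.

Lemma dirichletC (R : realType) (V : finType) (G : weighted_graph R V)
  (f g : V -> R) : dirichlet G f g = dirichlet G g f.
Proof.
by apply: eq_bigr => x _; apply: eq_bigr => y _; rewrite (mulrC (f y - f x)).
Qed.

Lemma mass_ge0 (R : realType) (V : finType) (G : weighted_graph R V)
  (f : V -> R) : 0 <= mass G f f.
Proof.
apply: sumr_ge0 => x _.
by rewrite mulr_ge0 ?vertex_weight_ge0// -expr2 sqr_ge0.
Qed.

Lemma dirichlet_ge0 (R : realType) (V : finType) (G : weighted_graph R V)
  (f : V -> R) : 0 <= dirichlet G f f.
Proof.
apply: sumr_ge0 => x _; apply: sumr_ge0 => y /weight_gt0/ltW w0.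
by rewrite mulr_ge0// -expr2 sqr_ge0.
Qed.

Lemma mass_laplacian_eq0 (R : realType) (V : finType) (G : weighted_graph R V)
    (f : V -> R) :
  mass G (laplacian G f) (laplacian G f) = 0 -> harmonic_on G f.
Proof.
move=> /eqP; rewrite psumr_eq0 => [/allP m0 x|x _]; last first.
  by rewrite mulr_ge0 ?vertex_weight_ge0// -expr2 sqr_ge0.
apply: laplacian_eq0; have /eqP := m0 x (mem_index_enum x).
by rewrite mulrA => /eqP; rewrite mulf_eq0 => /orP[/eqP//|/eqP ->]; rewrite mulr0.
Qed.

(** Each term is nonnegative with positive weight, so [f] takes equal values at the two ends of
    every edge. *)
Lemma dirichlet_eq0 (R : realType) (V : finType) (G : weighted_graph R V)
    (f : V -> R) : dirichlet G f f = 0 -> harmonic_on G f.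
Proof.
have h0 x y : edge G x y -> 0 <= weight G x y * ((f y - f x) * (f y - f x)).
  by move=> /weight_gt0/ltW w0; rewrite mulr_ge0// -expr2 sqr_ge0.
move=> /eqP; rewrite psumr_eq0 => [/allP d0 x|x _]; last exact: sumr_ge0 (h0 x).
have := d0 x (mem_index_enum x); rewrite /= psumr_eq0; last exact: h0.
move=> /allP dx0; apply: big1 => y xy.
have := dx0 y (mem_index_enum y); rewrite xy /= mulf_eq0 gt_eqF ?weight_gt0//=.
by rewrite mulf_eq0 orbb => /eqP ->; rewrite mulr0.
Qed.

(** Self-adjointness: applying [green] on both sides of [dirichletC] gives
    [mass (Lf) (Lf) = mass f (L(Lf)) = 0]. *)
Lemma harmonic_laplacian (R : realType) (V : finType) (G : weighted_graph R V)
    (f : V -> R) : harmonic_on G (laplacian G f) -> harmonic_on G f.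
Proof.
move=> LLf0; apply: mass_laplacian_eq0; apply/eqP.
rewrite -(mulrI_eq0 _ (lregP (_ : 2 != 0 :> R)))// -oppr_eq0 -green dirichletC green.
rewrite oppr_eq0 mulf_eq0 pnatr_eq0/= /mass big1// => x _.
by rewrite LLf0 !mulr0.
Qed.

(** * Time derivatives of the Laplacian and of the energies *)

Lemma is_derive_sum_seq (R : numFieldType) (I : Type) (r : seq I) (P : pred I)
    (h : I -> R -> R) (dh : I -> R) (t : R) :
  (forall i, P i -> is_derive t 1 (h i) (dh i)) ->
  is_derive t 1 (fun s => \sum_(i <- r | P i) h i s) (\sum_(i <- r | P i) dh i).
Proof.
move=> hP; elim: r => [|i r IH].
  have -> : (fun s => \sum_(i <- [::] | P i) h i s) = cst 0.
    by apply/funext => s; rewrite big_nil.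
  by rewrite big_nil; exact: is_derive_cst.
have -> : (fun s => \sum_(j <- i :: r | P j) h j s) =
    (fun s => if P i then h i s + \sum_(j <- r | P j) h j s
              else \sum_(j <- r | P j) h j s).
  by apply/funext => s; rewrite big_cons.
rewrite big_cons; case: ifPn => // Pi.
exact: is_deriveD (hP i Pi) IH.
Qed.

Lemma is_derive_laplacian (R : realType) (V : finType) (G : weighted_graph R V)
    (u : V -> R -> R) (du : V -> R) (t : R) x :
  (forall y, is_derive t 1 (u y) (du y)) ->
  is_derive t 1 (fun s => laplacian G (u ^~ s) x) (laplacian G du x).
Proof.
by move=> hu; apply: is_derive_sum_seq.
Qed.

Lemma is_derive_mass (R : realType) (V : finType) (G : weighted_graph R V)
    (u : V -> R -> R) (du : V -> R) (t : R) :
  (forall y, is_derive t 1 (u y) (du y)) ->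
  is_derive t 1 (fun s => mass G (u ^~ s) (u ^~ s)) (2 * mass G (u ^~ t) du).
Proof.
move=> hu; rewrite mulr_sumr; apply: is_derive_sum_seq => x _.
apply: (is_derive_eq (is_deriveZ (vertex_weight G x) (is_deriveM (hu x) (hu x)))).
by rewrite /GRing.scale/=; ring.
Qed.

Lemma is_derive_dirichlet (R : realType) (V : finType)
    (G : weighted_graph R V) (u : V -> R -> R) (du : V -> R) (t : R) :
  (forall y, is_derive t 1 (u y) (du y)) ->
  is_derive t 1 (fun s => dirichlet G (u ^~ s) (u ^~ s))
    (2 * dirichlet G (u ^~ t) du).
Proof.
move=> hu; rewrite mulr_sumr; apply: is_derive_sum_seq => x _.
rewrite mulr_sumr; apply: is_derive_sum_seq => y _.
have huxy := is_deriveB (hu y) (hu x).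
apply: (is_derive_eq (is_deriveZ (weight G x y) (is_deriveM huxy huxy))).
by rewrite /GRing.scale/= !fctE; ring.
Qed.

(** * Decay of a nonincreasing dissipation rate *)

Lemma le_before_average (R : realType) (A B dB : R -> R)
    (hA : forall t : R, t < 0 -> is_derive t 1 A (- B t))
    (hB : forall t : R, t < 0 -> is_derive t 1 B (dB t))
    (dB_le0 : forall t, t < 0 -> dB t <= 0)
    (A_ge0 : forall t, t < 0 -> 0 <= A t) (t r : R) :
  t < 0 -> 0 < r -> B t * r <= A (t - r).
Proof.
move=> t0 r0.
have mvt (f df : R -> R) a : (forall s : R, s < 0 -> is_derive s 1 f (df s)) ->
    a < t -> exists2 c, a < c < t & f t - f a = df c * (t - a).
  move=> hf a_t.
  have neg s : s <= t -> s < 0 by move=> /le_lt_trans; apply.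
  have df_in s : s \in `]a, t[ -> is_derive s 1 f (df s).
    by rewrite in_itv/= => /andP[_ /ltW/neg]; exact: hf.
  have [|c] := MVT a_t df_in; last by rewrite in_itv/=; exists c.
  apply: derivable_within_continuous => s; rewrite in_itv/= => /andP[_ /neg s0].
  by case: (hf s s0).
(* Going from [t - r] to [t], [A] loses [B c * r] for some intermediate [c]. The loss is at most
   [A (t - r)] because [A t >= 0], and [B c >= B t] because [B] is nonincreasing. *)
have [|c /andP[_ ct] Ac] := mvt A _ (t - r) hA; first by lra.
have [e /andP[_ et] Bc] := mvt B _ c hB ct.
have Btc : B t <= B c.
  by rewrite -subr_le0 Bc mulr_le0_ge0 ?subr_ge0 ?(ltW ct)// dB_le0// (lt_trans et).
have At := A_ge0 t t0.
have : B t * r <= B c * r by rewrite ler_pM2r.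
move: Ac; rewrite (_ : t - (t - r) = r); last by ring.
by nra.
Qed.

Lemma growth_drop (R : realType) (A B dB : R -> R)
    (hA : forall t : R, t < 0 -> is_derive t 1 A (- B t))
    (hB : forall t : R, t < 0 -> is_derive t 1 B (dB t))
    (dB_le0 : forall t, t < 0 -> dB t <= 0)
    (A_ge0 : forall t, t < 0 -> 0 <= A t) (K : R) (n : nat) :
  (forall t, t < 0 -> A t <= K * (1 - t) ^+ n.+1) ->
  forall t, t < 0 -> B t <= K * 2 ^+ n.+1 * (1 - t) ^+ n.
Proof.
move=> AK t t0.
(* Take [r = 1 - t]: then [1 - (t - r) = 2 * (1 - t)], which produces the power of 2, and dividing
   by [r] lowers the exponent by one. *)
have r0 : 0 < 1 - t by lra.
have := @le_before_average R A B dB hA hB dB_le0 A_ge0 t _ t0 r0.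
have tr0 : t - (1 - t) < 0 by lra.
move=> /le_trans/(_ (AK _ tr0)).
rewrite (_ : 1 - (t - (1 - t)) = 2 * (1 - t)); last by ring.
by rewrite exprMn (exprSr (1 - t)) !mulrA ler_pM2r.
Qed.

Lemma bounded_drop (R : realType) (A B dB : R -> R)
    (hA : forall t : R, t < 0 -> is_derive t 1 A (- B t))
    (hB : forall t : R, t < 0 -> is_derive t 1 B (dB t))
    (dB_le0 : forall t, t < 0 -> dB t <= 0)
    (A_ge0 : forall t, t < 0 -> 0 <= A t) (K : R) :
  (forall t, t < 0 -> A t <= K) -> forall t, t < 0 -> B t <= 0.
Proof.
move=> AK t t0; rewrite leNgt; apply/negP => Bt0.
have K0 : 0 <= K by apply: le_trans (AK t t0); exact: A_ge0.
(* This [r] makes [B t * r = K + 1], exceeding the bound [K] on [A]. *)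
have r0 : 0 < (K + 1) / B t by rewrite divr_gt0// ltr_wpDl.
have := @le_before_average R A B dB hA hB dB_le0 A_ge0 t _ t0 r0.
have tr0 : t - (K + 1) / B t < 0 by rewrite subr_lt0 (lt_trans t0).
rewrite mulrC divfK ?gt_eqF// => /le_trans/(_ (AK _ tr0)).
by rewrite gerDl ler10.
Qed.

(** * Energies along the heat flow and induction on the growth exponent *)

Section Energies.
Context (R : realType) (V : finType) (G : weighted_graph R V).
Context (u : V -> R -> R) (hu : heat_before_0 G u).

Local Notation Lu := (fun x t => laplacian G (u ^~ t) x).

(** The Laplacian is linear with coefficients independent of time, so it commutes with the time
    derivative. *)
Lemma heat_before_0_laplacian : heat_before_0 G Lu.
Proof. by move=> x t t0; apply: is_derive_laplacian => y; exact: hu. Qed.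

Lemma is_derive_mass_heat (t : R) : t < 0 ->
  is_derive t 1 (fun s => mass G (u ^~ s) (u ^~ s))
    (- dirichlet G (u ^~ t) (u ^~ t)).
Proof. by move=> t0; rewrite green opprK; apply: is_derive_mass => y; exact: hu. Qed.

Lemma is_derive_dirichlet_heat (t : R) : t < 0 ->
  is_derive t 1 (fun s => dirichlet G (u ^~ s) (u ^~ s))
    (- (4 * mass G (Lu ^~ t) (Lu ^~ t))).
Proof.
move=> t0; rewrite (_ : - _ = 2 * dirichlet G (u ^~ t) (laplacian G (u ^~ t))).
  by apply: is_derive_dirichlet => y; exact: hu.
by rewrite dirichletC green; ring.
Qed.

End Energies.

Lemma harmonic_of_mass_growth (R : realType) (V : finType)
    (G : weighted_graph R V) (n : nat) (u : V -> R -> R) (K : R) :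
  heat_before_0 G u ->
  (forall t, t < 0 -> mass G (u ^~ t) (u ^~ t) <= K * (1 - t) ^+ n.*2) ->
  forall t, t < 0 -> harmonic_on G (u ^~ t).
Proof.
elim: n u K => [|n IH] u K hu uK t t0.
  apply: dirichlet_eq0; apply/eqP; rewrite eq_le dirichlet_ge0 andbT.
  apply: (bounded_drop (is_derive_mass_heat hu) (is_derive_dirichlet_heat hu)) t0.
  - by move=> s _; rewrite oppr_le0 mulr_ge0// mass_ge0.
  - by move=> s _; exact: mass_ge0.
  - by move=> s /uK; rewrite expr0 mulr1; exact.
have hLu := heat_before_0_laplacian hu.
apply: harmonic_laplacian.
(* First of two drops: the exponent goes from [n.*2.+2] for the mass of [u] to [n.*2.+1] for its
   Dirichlet energy. *)
have DK : forall s, s < 0 ->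
    dirichlet G (u ^~ s) (u ^~ s) <= K * 2 ^+ n.*2.+2 * (1 - s) ^+ n.*2.+1.
  apply: (growth_drop (is_derive_mass_heat hu) (is_derive_dirichlet_heat hu)) => //.
  - by move=> s _; rewrite oppr_le0 mulr_ge0// mass_ge0.
  - by move=> s _; exact: mass_ge0.
have hB (s : R) : s < 0 -> is_derive s 1
    (fun s => 4 * mass G (laplacian G (u ^~ s)) (laplacian G (u ^~ s)))
    (4 * - dirichlet G (laplacian G (u ^~ s)) (laplacian G (u ^~ s))).
  by move=> s0; exact: (is_deriveZ (4 : R) (is_derive_mass_heat hLu s0)).
(* Second drop, to [n.*2] for the mass of [Lu]. It bounds 4 times that mass, and the factor 4 is
   discarded. *)
apply: (IH (fun x s => laplacian G (u ^~ s) x)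
  (K * 2 ^+ n.*2.+2 * 2 ^+ n.*2.+1) hLu) t0 => s s0.
apply: (le_trans _ (growth_drop (is_derive_dirichlet_heat hu) hB _ _ DK s0)).
- by apply: ler_peMl; [exact: mass_ge0|rewrite ler1n].
- by move=> r _; rewrite mulrN oppr_le0 mulr_ge0// dirichlet_ge0.
- by move=> r _; exact: dirichlet_ge0.
Qed.

(** * From derivatives within a set to ordinary derivatives and continuity *)

Lemma is_derive_within_interior (R : realType) (D : set R) (f : R -> R)
    (t df : R) : nbhs t D -> is_derive_within D f t df -> is_derive t 1 f df.
Proof.
move=> Dt hf.
have quot : h^-1 *: (f (h *: 1 + t) - f t) @[h --> (0 : R)^'] --> df.
  apply/cvgrPdist_lt => e e0; move/cvgrPdist_lt/(_ _ e0): hf => hf.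
  have : \forall s \near t, s != t -> `|df - (f s - f t) / (s - t)| < e.
    have {}hf : \forall s \near t, s != t -> D s ->
      `|df - (f s - f t) / (s - t)| < e := hf.
    by apply: filterS2 hf Dt => s hs Ds st; exact: hs.
  move=> /nbhs_ballP[r r0 hr]; apply/nbhs_ballP; exists r => // h.
  rewrite /ball/= sub0r normrN => hlt h0.
  have := hr (h + t); rewrite /ball/= opprD addrCA subrr addr0 normrN addrK.
  rewrite [h%:A]mulr1 [_ *: _]mulrC; apply=> //.
  by rewrite -subr_eq0 addrK.
apply: DeriveDef; first by apply/cvg_ex; exists df.
exact: cvg_lim quot.
Qed.

Lemma is_derive_within_cvg (R : realType) (D : set R) (f : R -> R)
    (t df : R) : is_derive_within D f t df -> f s @[s --> within D t^'] --> f t.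
Proof.
move=> hf.
have st : s @[s --> within D t^'] --> t.
  by apply: (@cvg_trans _ t^'); exact: cvg_within.
(* This expression equals [f s] for [s != t], and its first summand tends to [df * 0]. *)
have : (f s - f t) / (s - t) * (s - t) + f t @[s --> within D t^'] --> f t.
  rewrite -[X in _ --> X]add0r -(mulr0 df) -(subrr t).
  by apply: cvgD; [apply: cvgM => //; apply: cvgB => //|]; exact: cvg_cst.
apply: cvg_trans; apply: near_eq_cvg.
have st_neq : within D t^' [set s | s != t] by exact: (@filterE _ (nbhs t)).
apply: filterS st_neq => s /= s_t.
by rewrite divfK ?subr_eq0// subrK.
Qed.

Lemma heat_before_0_ancient (R : realType) (V : finType)
    (G : weighted_graph R V) (u : V -> R -> R) :
  ancient_heat_solution G u -> heat_before_0 G u.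
Proof.
move=> hu x t t0; apply: is_derive_within_interior (hu x t (ltW t0)).
by apply: filterS (lt_nbhsl t0) => s; exact: ltW.
Qed.

(** * Polynomial growth of the mass, and the conclusion *)

Lemma heat_mass_growth (R : realType) (V : finType) (G : weighted_graph R V)
    (u : V -> R -> R) (x0 : V) (C d : R) : 0 < C ->
  (forall (x : V) (t : R), t <= 0 ->
    `|u x t| <= C * (1 + (graph_dist G x0 x)%:R + Num.sqrt (- t)) `^ d) ->
  exists (K : R) (n : nat), forall t, t < 0 ->
    mass G (u ^~ t) (u ^~ t) <= K * (1 - t) ^+ n.*2.
Proof.
move=> C0 hu; pose n := (Num.truncn d).+1; pose N : R := 1 + #|V|%:R.
exists (\sum_x vertex_weight G x * (C * (2 * N ^+ 2) ^+ n) ^+ 2), n => t t0.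
have N1 : 1 <= N by rewrite lerDl.
have t1 : 0 <= 1 - t by lra.
have N0 : 0 <= N by lra.
have P0 : 0 <= 2 * N ^+ 2 by rewrite mulr_ge0 ?sqr_ge0.
rewrite mulr_suml; apply: ler_sum => x _.
rewrite -mulrA ler_wpM2l ?vertex_weight_ge0// -expr2 -muln2 exprM -exprMn.
rewrite -real_normK ?num_real// lerXn2r ?nnegrE//.
  by rewrite !mulr_ge0 ?exprn_ge0 ?(ltW C0).
apply: le_trans (hu x t (ltW t0)) _; rewrite -mulrA ler_pM2l// -exprMn.
set b := 1 + _ + _.
have sq0 := sqrtr_ge0 (- t).
have dN : (graph_dist G x0 x)%:R <= #|V|%:R :> R.
  by rewrite ler_nat -[X in (_ <= X)%N](size_iota 0) find_size.
have d0 : 0 <= (graph_dist G x0 x)%:R :> R by [].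
have b1 : 1 <= b by rewrite /b; lra.
(* As [b >= 1] and [d < n <= 2 * n], the real power is at most a natural one; the even exponent lets
   [b ^+ 2] absorb the square root. *)
apply: (@le_trans _ _ (b ^+ (2 * n))).
  rewrite -powR_mulrn ?(le_trans _ b1)//; apply: ler_powR => //.
  apply: (le_trans (ltW (truncnS_gt d))).
  by rewrite ler_nat leq_pmull.
rewrite exprM lerXn2r ?nnegrE ?sqr_ge0 ?mulr_ge0//.
have sqE : Num.sqrt (- t) ^+ 2 = - t by rewrite sqr_sqrtr//; lra.
have bN : b <= N + Num.sqrt (- t) by rewrite /b /N; lra.
(* With [s = sqrt (- t)]: [(N + s)^2 <= 2 * (N^2 + s^2) = 2 * (N^2 - t) <= 2 * N^2 * (1 - t)]; the
   last inequality is this one, doubled. *)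
have N1sq : 0 <= (N ^+ 2 - 1) * - t.
  by rewrite mulr_ge0 ?oppr_ge0 ?(ltW t0)// subr_ge0 exprn_ege1.
have := sqr_ge0 (N - Num.sqrt (- t)).
have : b ^+ 2 <= (N + Num.sqrt (- t)) ^+ 2.
  by rewrite lerXn2r ?nnegrE ?addr_ge0// (le_trans _ b1).
by lra.
Qed.

Theorem theorem1p3 (R : realType) (V : finType) (G : weighted_graph R V)
  (conn : connected_graph G) (u : V -> R -> R)
  (heat : ancient_heat_solution G u)
  (growth : exists (x0 : V) (C d : R), 0 < C /\ 0 < d /\
     forall (x : V) (t : R), t <= 0 ->
       `|u x t| <= C * (1 + (graph_dist G x0 x)%:R + Num.sqrt (- t)) `^ d) :
  exists h : V -> R, harmonic_on G h /\
    forall (x : V) (t : R), t <= 0 -> u x t = h x.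
Proof.
have hu := heat_before_0_ancient heat.
have [x0 [C [d [C0 [_ hC]]]]] := growth.
have [K [n hK]] := heat_mass_growth C0 hC.
have u_harm := harmonic_of_mass_growth hu hK.
(* Any negative time would serve as well as [-1], since [u] turns out constant there. *)
exists (u ^~ (-1)); split; first by apply: u_harm; lra.
(* Each time slice is harmonic, so the heat equation makes the time derivative zero. *)
have const x s t : s < t -> t < 0 -> u x s = u x t.
  move=> st t0.
  have du r : r <= t -> is_derive r 1 (u x) 0.
    move=> rt; have r0 := le_lt_trans rt t0.
    by rewrite -(u_harm r r0 x); exact: hu.
  have du_in r : r \in `]s, t[ -> is_derive r 1 (u x) 0.
    by rewrite in_itv/= => /andP[_ /ltW/du].
  have [|c _ /eqP] := MVT st du_in; last by rewrite mul0r subr_eq0 => /eqP.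
  apply: derivable_within_continuous => r; rewrite in_itv/= => /andP[_ /du].
  by case.
have const1 x t : t < 0 -> u x t = u x (-1).
  by move=> t0; have [/const|/const ->|->] := ltgtP t (-1) => //; apply; lra.
move=> x t; rewrite le_eqVlt => /predU1P[->|]; last exact: const1.
(* At time 0 the one-sided derivative gives left continuity, so [u x 0] is the left limit of a
   function constant on negative times. *)
have left0 : u x s @[s --> (0 : R)^'-] --> u x 0.
  apply: cvg_trans (is_derive_within_cvg (heat x 0 (lexx 0))).
  apply: cvg_app => A hA.
  have {}hA : \forall s \near (0 : R), s != 0 -> s <= 0 -> A s := hA.
  apply: (filterS _ hA) => s hs s0.
  by apply: hs; [rewrite lt_eqF|exact: ltW].
have left1 : u x s @[s --> (0 : R)^'-] --> u x (-1).
  apply: cvg_near_cst; near=> s; apply: const1.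
  by near: s; exact: nbhs_left_lt.
exact: (cvg_unique _ left0 left1).
Unshelve. all: by end_near. Qed.
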